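(* Let $n\ge 1$, let $r\ge2$ and let $\mathcal{F}\subseteq\binom{[n]}{r}$. Then there is a shifted family $\mathcal{H}\subseteq\binom{[n]}{r}$ with $|\mathcal{H}|=|\mathcal{F}|$ and $$\tfrac12\bigl|\mathcal{F}\,\triangle\,\mathcal{H}\bigr|\ \le\ \mathrm{shdef}(\mathcal{F}).$$ In particular $\mathrm{dist}_{\mathrm{sh}}(\mathcal{F})\le\mathrm{shdef}(\mathcal{F})$.
   Context: $[n]=\{1,\dots,n\}$ with its usual order, and $\binom{[n]}{r}$ is the set of $r$-element subsets of $[n]$. $\triangle$ denotes symmetric difference. For $i<j$ in $[n]$ and $F\in\binom{[n]}{r}$ with $j\in F$, $i\notin F$, put $S_{ij}(F)=(F\setminus\{j\})\cup\{i\}$. A family $\mathcal{F}\subseteq\binom{[n]}{r}$ is *shifted* if $S_{ij}(F)\in\mathcal{F}$ whenever $F\in\mathcal{F}$, $i<j$, $j\in F$ and $i\notin F$. For $i<j$ let $N_{ij}(\mathcal{F})=|\{F\in\mathcal{F}: j\in F,\ i\notin F\}|$ and $R_{ij}(\mathcal{F})=|\{F\in\mathcal{F}: j\in F,\ i\notin F,\ S_{ij}(F)\in\mathcal{F}\}|$. The *shifting defect* is $\mathrm{shdef}(\mathcal{F})=\sum_{1\le i<j\le n}\bigl(N_{ij}(\mathcal{F})-R_{ij}(\mathcal{F})\bigr)$. The *distance to shiftedness* is $$\mathrm{dist}_{\mathrm{sh}}(\mathcal{F})=\min\Bigl\{\tfrac12|\mathcal{F}\,\triangle\,\mathcal{H}|:\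 \mathcal{H}\subseteq\tbinom{[n]}{r}\text{ shifted},\ |\mathcal{H}|=|\mathcal{F}|\Bigr\}.$$ The families $\mathcal{H}$ need not use every label of $[n]$. *)

(* Defs.v *)
From HB Require Import structures.
From mathcomp Require Import all_boot all_order all_algebra.

Set Implicit Arguments.
Unset Strict Implicit.
Unset Printing Implicit Defensive.

Import Order.TTheory GRing.Theory Num.Theory.
Local Open Scope ring_scope.

(* The ordered set [n] = {1, ..., n} is represented by 'I_n = {0, ..., n-1}
   with its usual order: label k corresponds to the ordinal k-1.              *)

Definition rsubsets (n r : nat) : {set {set 'I_n}} :=
  [set A : {set 'I_n} | #|A| == r].

Definition symdiff (T : finType) (A B : {set T}) : {set T} :=
  (A :\: B) :|: (B :\: A).

(* Only meaningful when i < j, j \in A and i \notin A; shifted and shdef only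
   apply it in that case.                                                     *)
Definition shift (n : nat) (i j : 'I_n) (A : {set 'I_n}) : {set 'I_n} :=
  i |: (A :\ j).

Definition shiftable (n : nat) (i j : 'I_n) (A : {set 'I_n}) : bool :=
  [&& (i < j)%N, j \in A & i \notin A].

Definition shifted (n : nat) (F : {set {set 'I_n}}) : bool :=
  [forall A in F, forall i : 'I_n, forall j : 'I_n,
     shiftable i j A ==> (shift i j A \in F)].

Definition Nshift (n : nat) (i j : 'I_n) (F : {set {set 'I_n}}) : nat :=
  #|[set A in F | (j \in A) && (i \notin A)]|.

Definition Rshift (n : nat) (i j : 'I_n) (F : {set {set 'I_n}}) : nat :=
  #|[set A in F | [&& j \in A, i \notin A & shift i j A \in F]]|.

Definition shdef (n : nat) (F : {set {set 'I_n}}) : rat :=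
  \sum_(i < n) \sum_(j < n | (i < j)%N)
    ((Nshift i j F)%:R - (Rshift i j F)%:R).

Definition half_symdiff (n : nat) (F H : {set {set 'I_n}}) : rat :=
  #|symdiff F H|%:R / 2.

Definition sh_candidate (n r : nat) (F H : {set {set 'I_n}}) : bool :=
  [&& H \subset rsubsets n r, shifted H & #|H| == #|F|].

(* The neutral value #|F| of the iterated minimum is an upper bound of
   half_symdiff F H for every H with #|H| = #|F|, so it does not affect the
   minimum; dist_shP below shows that this is a genuine, attained minimum.    *)
Definition dist_sh (n r : nat) (F : {set {set 'I_n}}) : rat :=
  \big[Order.min/#|F|%:R]_(H : {set {set 'I_n}} | sh_candidate r F H)
    half_symdiff F H.

Lemma half_symdiff_le (n : nat) (F H : {set {set 'I_n}}) :
  #|H| = #|F| -> half_symdiff F H <= #|F|%:R.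
Proof.
move=> eqHF; rewrite /half_symdiff ler_pdivrMr // -natrM ler_nat.
rewrite muln2 -addnn (leq_trans (leq_card_setU _ _)) //.
by apply: leq_add; [|rewrite -eqHF]; rewrite subset_leq_card // subsetDl.
Qed.

Lemma card_shift (n : nat) (i j : 'I_n) (A : {set 'I_n}) :
  shiftable i j A -> #|shift i j A| = #|A|.
Proof.
case/and3P=> ltij jA iA; rewrite /shift cardsU1 !inE (negPf iA) andbF /=.
by rewrite (cardsD1 j A) jA.
Qed.

Lemma sum_shift (n : nat) (i j : 'I_n) (A : {set 'I_n}) :
  shiftable i j A -> (\sum_(k in shift i j A) k < \sum_(k in A) k)%N.
Proof.
case/and3P=> ltij jA iA; rewrite /shift big_setU1 /=; last first.
  by rewrite !inE (negPf iA) andbF.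
by rewrite (big_setD1 j jA) /= ltn_add2r.
Qed.

Lemma shifted_exists (n r m : nat) : (m <= #|rsubsets n r|)%N ->
  exists H : {set {set 'I_n}},
    [/\ H \subset rsubsets n r, shifted H & #|H| = m].
Proof.
move=> /subKn <-; elim: (_ - m)%N => [|k [H [sH shH cH]]].
  exists (rsubsets n r); rewrite subn0; split=> //.
  apply/forall_inP => A; rewrite inE => /eqP cA.
  apply/forallP=> i; apply/forallP=> j; apply/implyP=> sA.
  by rewrite inE card_shift ?cA.
have [H0|[A0 A0H]] := set_0Vmem H.
  by exists H; split=> //; rewrite subnS -cH H0 cards0.
pose w (A : {set 'I_n}) := (\sum_(k in A) k)%N.
case: (arg_maxnP w A0H) => B /= BH maxB; have {}BH : B \in H by [].
exists (H :\ B); split.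
- exact: subset_trans (subsetDl _ _) sH.
- apply/forall_inP => A /setD1P[_ AH].
  apply/forallP=> i; apply/forallP=> j; apply/implyP=> sA.
  rewrite !inE; apply/andP; split; last first.
    by move: shH => /forall_inP/(_ A AH)/forallP/(_ i)/forallP/(_ j)/implyP->.
  apply/eqP=> eB; have := sum_shift sA; rewrite eB ltnNge.
  by apply/negP/negPn; apply: maxB.
- by rewrite subnS -cH (cardsD1 B H) BH.
Qed.

Lemma dist_shP (n r : nat) (F : {set {set 'I_n}}) : F \subset rsubsets n r ->
  (exists2 H, sh_candidate r F H & dist_sh r F = half_symdiff F H) /\
  (forall H, sh_candidate r F H -> dist_sh r F <= half_symdiff F H).
Proof.
move=> sF; split; last by move=> H cH; apply: bigmin_le_cond.
have [H0 [sH0 shH0 cH0]] := shifted_exists (subset_leq_card sF).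
have cand0 : sh_candidate r F H0 by rewrite /sh_candidate sH0 shH0 cH0 eqxx.
rewrite /dist_sh (bigmin_eq_arg _ _ _ _ cand0) => [|H /and3P[_ _ /eqP]]; last first.
  exact: half_symdiff_le.
by case: arg_minP => // H cH _; exists H.
Qed.

(* Main.v *)
Require Import Defs.
From mathcomp Require Import all_boot all_order all_algebra.
From mathcomp Require Import fingroup perm zify.
Set Implicit Arguments.
Unset Strict Implicit.
Unset Printing Implicit Defensive.
Import Order.TTheory GRing.Theory Num.Theory.
Local Open Scope ring_scope.

(** Replace [F] by its compression [G] along a pair [i < j] for which the
defect is [m > 0].  This moves [m] members of [F], so it is enough that it
lowers [shdef] by at least [m].  Now [shdef] is [sum N - sum R].  The number of
shifts of an [r]-set is its element sum minus a constant, so it drops whenever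
a set is shifted, and [sum N] drops by at least [m].  The number [sum R] of
edges of the Johnson graph inside [F] does not drop: the transposition [(i j)]
is an automorphism of that graph, and an edge from a set containing [i] but not
[j] to a set containing [j] but not [i] joins a set to its own image. *)

(** * Transpositions of two labels acting on sets *)

Section Swap.
Variable n : nat.
Implicit Types (i j k l x : 'I_n) (A B : {set 'I_n}).

(** Unlike [shift], this is a bijection on all sets, so sums can be reindexed by it. Preimage and
    image agree, a transposition being an involution. *)
Definition swap i j A : {set 'I_n} := tperm i j @^-1: A.

Lemma in_swap i j A x : (x \in swap i j A) = (tperm i j x \in A).
Proof. by rewrite inE. Qed.

Lemma swapK i j : involutive (swap i j).
Proof. by move=> A; apply/setP=> x; rewrite !in_swap tpermK. Qed.

Lemma swapC i j A : swap i j A = swap j i A.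
Proof. by rewrite /swap tpermC. Qed.

Lemma card_swap i j A : #|swap i j A| = #|A|.
Proof. exact/card_preimset/perm_inj. Qed.

Lemma swap_fix i j A : (i \in A) = (j \in A) -> swap i j A = A.
Proof. by move=> e; apply/setP=> x; rewrite in_swap; case: tpermP => // ->. Qed.

Lemma swap_eq i j A : (swap i j A == A) = ((i \in A) == (j \in A)).
Proof.
apply/eqP/eqP=> [e|]; last exact: swap_fix.
by rewrite -{1}e in_swap tpermL.
Qed.

Lemma shift_swap i j A : j \in A -> i \notin A -> shift i j A = swap i j A.
Proof.
move=> jA iA; apply/setP=> x; rewrite /shift in_swap !inE.
case: tpermP => [->|->|]; first by rewrite eqxx jA.
  rewrite eqxx orbF (negPf iA); apply/negbTE/eqP => eji.
  by rewrite eji (negPf iA) in jA.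
by move=> /eqP/negPf -> /eqP/negPf ->.
Qed.

(** Conjugating [(k l)] by [(i j)] gives the transposition of the images of [k] and [l]; hence
    [swap i j] respects adjacency in the Johnson graph. *)
Lemma swapJ i j k l A :
  swap (tperm i j k) (tperm i j l) (swap i j A) = swap i j (swap k l A).
Proof.
apply/setP=> x; rewrite !in_swap (inj_tperm _ _ _ (@perm_inj _ (tperm i j))).
by rewrite !tpermK.
Qed.

(** Swapping [k] and [l] can remove [i] and add [j] only if [{k, l} = {i, j}]. *)
Lemma swap_crossing i j k l A :
  i \in A -> j \notin A -> i \notin swap k l A -> j \in swap k l A ->
  swap k l A = swap i j A.
Proof.
move=> iA jA; rewrite !in_swap.
case: tpermP => [->|->|_ _]; last by rewrite iA.
- case: tpermP => [->|->|_ _]; [by move=> /negPf->| by []| by rewrite (negPf jA)].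
- case: tpermP => [->|->|_ _]; [by rewrite swapC|by move=> /negPf->|].
  by rewrite (negPf jA).
Qed.

End Swap.

(** * The number of shifts of a set and its element sum *)

Section ShiftCount.
Variable n : nat.
Implicit Types (i j : 'I_n) (A : {set 'I_n}).

Definition nshifts A : nat :=
  (\sum_(i < n) \sum_(j < n | (i < j)%N) ((j \in A) && (i \notin A)))%N.

Definition ninner A : nat := (\sum_(j in A) \sum_(i in A) (i < j))%N.

(** Ordered pairs from [A] split into the diagonal and two halves of equal size, so [ninner A]
    depends only on [#|A|]. *)
Lemma ninnerE A : (2 * ninner A + #|A| = #|A| * #|A|)%N.
Proof.
have e1 : (\sum_(j in A) \sum_(i in A) (i == j) = #|A|)%N.
  rewrite -sum1_card; apply: eq_bigr => j jA.
  rewrite (bigD1 j) //= eqxx big1 // => i /andP[_ /negPf->] //.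
have e2 : ninner A = (\sum_(j in A) \sum_(i in A) (j < i))%N.
  by rewrite /ninner exchange_big.
rewrite mul2n -addnn {2}e2 -{1}e1 /ninner -!big_split /= -sum_nat_const.
apply: eq_bigr => j jA; rewrite -!big_split /= -sum1_card.
by apply: eq_bigr => i iA; rewrite -val_eqE /=; case: (ltngtP i j).
Qed.

(** Labels start at 0, so exactly [j] labels lie below [j]: those outside [A] give shifts, those
    inside are counted by [ninner]. *)
Lemma nshiftsE A : (nshifts A + ninner A = \sum_(j in A) j)%N.
Proof.
have -> : nshifts A = (\sum_(j in A) \sum_(i < n | i \notin A) (i < j))%N.
  rewrite /nshifts (eq_bigr _ (fun i _ => big_mkcond _ _)) exchange_big /=.
  rewrite [RHS]big_mkcond; apply: eq_bigr => j _.
  case: ifP => jA; last by rewrite big1 // => i _; case: ifP.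
  rewrite [RHS]big_mkcond; apply: eq_bigr => i _ /=.
  by case: (i < j)%N; case: (i \in A).
rewrite /ninner -big_split /=; apply: eq_bigr => j jA.
rewrite addnC -(bigID (mem A) xpredT (fun i : 'I_n => nat_of_bool (i < j)%N)) /=.
rewrite -[RHS]card_ord -sum1_card (big_ord_widen n (fun=> 1%N) (ltnW (ltn_ord j))) /=.
by rewrite [RHS]big_mkcond; apply: eq_bigr => i _; case: (i < j)%N.
Qed.

Lemma nshifts_swap i j A : (i < j)%N -> j \in A -> i \notin A ->
  (nshifts (swap i j A) < nshifts A)%N.
Proof.
move=> ltij jA iA.
have sA : shiftable i j A by rewrite /shiftable ltij jA.
have := sum_shift sA; rewrite shift_swap // -!nshiftsE.
suff -> : ninner (swap i j A) = ninner A by rewrite ltn_add2r.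
have := ninnerE (swap i j A); rewrite card_swap -ninnerE; lia.
Qed.

End ShiftCount.

(** * The two sums in the defect, and edges inside a family *)

Section Compression.
Variable n : nat.
Implicit Types (i j k l : 'I_n) (A B : {set 'I_n}) (F G H : {set {set 'I_n}}).

Definition Nsum F : nat :=
  (\sum_(i < n) \sum_(j < n | (i < j)%N) Nshift i j F)%N.
Definition Rsum F : nat :=
  (\sum_(i < n) \sum_(j < n | (i < j)%N) Rshift i j F)%N.

Lemma leq_Rsum_Nsum F : (Rsum F <= Nsum F)%N.
Proof.
apply: leq_sum => i _; apply: leq_sum => j _; apply/subset_leq_card/subsetP.
by move=> A; rewrite !inE => /and4P[-> -> ->].
Qed.

Lemma shdefE F : shdef F = (Nsum F)%:R - (Rsum F)%:R.
Proof.
rewrite /shdef /Nsum /Rsum !natr_sum -sumrB; apply: eq_bigr => i _.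
by rewrite !natr_sum -sumrB.
Qed.

Lemma NsumE F : Nsum F = (\sum_(A in F) nshifts A)%N.
Proof.
rewrite /Nsum /nshifts [RHS]exchange_big; apply: eq_bigr => i _ /=.
rewrite [RHS]exchange_big; apply: eq_bigr => j _ /=.
rewrite /Nshift -sum1_card [LHS]big_mkcond [RHS]big_mkcond /=.
apply: eq_bigr => A _; rewrite inE.
by case: (A \in F); case: (j \in A); case: (i \in A).
Qed.

(** Unlike the condition in [Rshift], this indicator is symmetric in [k] and [l] and in the two
    endpoints, which suits reindexing. The first test discards loops. *)
Definition edge F k l A : nat :=
  [&& swap k l A != A, A \in F & swap k l A \in F].

Lemma edge_Rshift F k l : (\sum_A edge F k l A = 2 * Rshift k l F)%N.
Proof.
have -> : Rshift k l F = (\sum_(A : {set 'I_n}) [&& l \in A, k \notin A & edge F k l A == 1])%N.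
  rewrite /Rshift -sum1_card big_mkcond; apply: eq_bigr => A _ /=.
  rewrite inE /edge swap_eq.
  case kA: (k \in A); case lA: (l \in A); rewrite /= ?andbF //.
  by rewrite shift_swap ?kA //; case: (A \in F); case: (_ \in F).
(* One copy counts each edge at its endpoint containing [l] but not [k]; the reindexed copy counts
   it at the other endpoint. *)
rewrite mul2n -addnn [X in (_ = X + _)%N](reindex_inj (inv_inj (@swapK n k l))) /=.
rewrite -big_split; apply: eq_bigr => A _ /=.
rewrite /edge swapK !in_swap tpermL tpermR [A == _]eq_sym swap_eq.
by case: (k \in A); case: (l \in A); case: (A \in F); case: (_ \in F).
Qed.

(* Every edge is counted four times: once for each endpoint [A] and for each
   order of the two swapped labels. *)
Lemma Rsum_edge F :
  (\sum_(k < n) \sum_(l < n) \sum_A edge F k l A = 4 * Rsum F)%N.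
Proof.
have split3 k : (\sum_(l < n) \sum_A edge F k l A =
    \sum_(l < n | k < l) \sum_A edge F k l A +
    \sum_(l < n | l < k) \sum_A edge F k l A)%N.
  rewrite [X in (X + _)%N]big_mkcond [X in (_ + X)%N]big_mkcond -big_split /=.
  apply: eq_bigr => l _.
  case: ltngtP => [_|_|/ord_inj <-]; rewrite ?addn0 //.
  by apply: big1 => A _; rewrite /edge swap_eq eqxx.
rewrite (eq_bigr _ (fun k _ => split3 k)) big_split /=.
have -> : (\sum_(k < n) \sum_(l < n | l < k) \sum_A edge F k l A =
           \sum_(k < n) \sum_(l < n | k < l) \sum_A edge F k l A)%N.
  rewrite (eq_bigr _ (fun k _ => big_mkcond _ _)) exchange_big /=.
  apply: eq_bigr => k _; rewrite -big_mkcond; apply: eq_bigr => l _.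
  by apply: eq_bigr => A _; rewrite /edge swapC.
have -> : (\sum_(k < n) \sum_(l < n | k < l) \sum_A edge F k l A = 2 * Rsum F)%N.
  rewrite /Rsum big_distrr; apply: eq_bigr => k _; rewrite big_distrr.
  by apply: eq_bigr => l _; apply: edge_Rshift.
lia.
Qed.

(** * Compression along a pair of labels *)

Definition moved i j F :=
  [set A in F | [&& j \in A, i \notin A & swap i j A \notin F]].

Definition compress i j F := (F :\: moved i j F) :|: (swap i j @^-1: moved i j F).

(** Compression acts separately on each pair [A], [swap i j A]: if exactly one of two distinct sets
    lies in [F], the one containing [i] is kept; otherwise nothing changes. *)
Lemma in_compress i j F A : (A \in compress i j F) =
  if (i \in A) == (j \in A) then A \in F
  else if i \in A then (A \in F) || (swap i j A \in F)
  else (A \in F) && (swap i j A \in F).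
Proof.
rewrite !inE swapK ?in_swap ?tpermL ?tpermR.
by case: (i \in A); case: (j \in A); case: (A \in F); case: (swap i j A \in F).
Qed.

Lemma compress_disjoint i j F :
  [disjoint F :\: moved i j F & swap i j @^-1: moved i j F].
Proof.
rewrite disjoint_subset; apply/subsetP=> A; rewrite !inE swapK.
by case: (A \in F); rewrite ?andbF.
Qed.

Lemma sum_compress i j F (f : {set 'I_n} -> nat) :
  (\sum_(A in compress i j F) f A + \sum_(A in moved i j F) f A =
   \sum_(A in F) f A + \sum_(A in moved i j F) f (swap i j A))%N.
Proof.
have -> : (\sum_(A in compress i j F) f A =
  \sum_(A in [predU F :\: moved i j F & swap i j @^-1: moved i j F]) f A)%N.
  by apply: eq_bigl => A; rewrite in_setU.
rewrite bigU ?compress_disjoint //=.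
rewrite (big_setID (moved i j F) (A := F)) /=.
have -> : F :&: moved i j F = moved i j F.
  by apply/setIidPr/subsetP=> A; rewrite inE => /andP[].
have -> : (\sum_(A in swap i j @^-1: moved i j F) f A =
           \sum_(A in moved i j F) f (swap i j A))%N.
  rewrite (reindex_inj (inv_inj (@swapK n i j))); apply: eq_bigl => A.
  by rewrite inE swapK.
by rewrite addnC addnA.
Qed.

Lemma card_compress i j F : #|compress i j F| = #|F|.
Proof.
by have := sum_compress i j F (fun=> 1%N); rewrite !sum1_card => /addIn.
Qed.

Lemma compress_rsubsets r i j F :
  F \subset rsubsets n r -> compress i j F \subset rsubsets n r.
Proof.
move=> /subsetP sF; apply/subsetP=> A; rewrite in_setU => /orP[].
  by case/setDP=> /sF.
by rewrite !inE -(card_swap i j A) => /andP[/sF]; rewrite inE.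
Qed.

(** Each moved set is traded for its shift, which admits at least one shift fewer. *)
Lemma Nsum_compress i j F : (i < j)%N ->
  (Nsum (compress i j F) + #|moved i j F| <= Nsum F)%N.
Proof.
move=> ltij; have := sum_compress i j F (@nshifts n).
rewrite -!NsumE [Nsum (moved _ _ _)]NsumE => e.
rewrite -(leq_add2r (\sum_(A in moved i j F) nshifts (swap i j A))%N).
rewrite -{}e -addnA leq_add2l addnC.
rewrite -sum1_card -big_split /=; apply: leq_sum => A.
by rewrite inE addn1 => /and4P[_ jA iA _]; apply: nshifts_swap.
Qed.

(** A single edge may be destroyed, so it is counted together with its image. Let [B = swap k l A].
    If [swap i j] fixes [A] or [B], the total is unchanged. If both contain the same single one of
    [i], [j], the indicators of each swapped pair become their maximum and minimum, and the sum of
    products cannot drop. Otherwise [B = swap i j A], and an edge with both ends in [F] survives. *)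
Lemma edge_compress i j F k l A :
  (edge F k l A + edge F (tperm i j k) (tperm i j l) (swap i j A) <=
   edge (compress i j F) k l A +
   edge (compress i j F) (tperm i j k) (tperm i j l) (swap i j A))%N.
Proof.
rewrite /edge swapJ (inj_eq (inv_inj (@swapK n i j))).
have [//|neAB] /= := eqVneq (swap k l A) A.
set B := swap k l A in neAB *.
rewrite !in_compress !swapK !(in_swap i j) tpermL tpermR.
have cross : i \in A -> j \notin A -> i \notin B -> j \in B -> B = swap i j A.
  exact: swap_crossing.
have cross' : j \in A -> i \notin A -> j \notin B -> i \in B -> B = swap i j A.
  by rewrite (swapC i); apply: swap_crossing.
case iA: (i \in A) cross cross'; case jA: (j \in A);
case iB: (i \in B); case jB: (j \in B) => cross cross' /=.
all: try (have eB := cross isT isT isT isT).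
all: try (have eB := cross' isT isT isT isT).
all: try rewrite !eB !swapK.
all: have fixA := @swap_fix n i j A; have fixB := @swap_fix n i j B.
all: rewrite ?iA ?jA in fixA; rewrite ?iB ?jB in fixB.
all: try rewrite !(fixA erefl).
all: try rewrite !(fixB erefl).
all: try case: (A \in F); try case: (B \in F);
  try case: (swap i j A \in F); try case: (swap i j B \in F); by [].
Qed.

Lemma Rsum_compress i j F : (Rsum F <= Rsum (compress i j F))%N.
Proof.
(* The factor 4 is that of [Rsum_edge]; the factor 2 pairs each term with its image under
   [swap i j]. *)
suff H : (2 * (4 * Rsum F) <= 2 * (4 * Rsum (compress i j F)))%N by lia.
have sym G : (2 * (4 * Rsum G) = \sum_(k < n) \sum_(l < n) \sum_A
    (edge G k l A + edge G (tperm i j k) (tperm i j l) (swap i j A)))%N.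
  have inj_t := @perm_inj _ (tperm i j).
  rewrite -Rsum_edge mul2n -addnn {2}(reindex_inj inj_t) -big_split /=.
  apply: eq_bigr => k _; rewrite [X in (_ + X)%N](reindex_inj inj_t) -big_split /=.
  apply: eq_bigr => l _.
  rewrite [X in (_ + X)%N](reindex_inj (inv_inj (@swapK n i j))) -big_split /=.
  by [].
rewrite !sym; apply: leq_sum => k _; apply: leq_sum => l _; apply: leq_sum => A _.
exact: edge_compress.
Qed.

(** * Distance travelled under repeated compression *)

Lemma card_symdiff_compress i j F :
  (#|symdiff F (compress i j F)| <= 2 * #|moved i j F|)%N.
Proof.
have cardV : #|swap i j @^-1: moved i j F| = #|moved i j F|.
  exact/card_preimset/inv_inj/swapK.
rewrite mul2n -addnn -{2}cardV.
apply: leq_trans (leq_card_setU _ _).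
apply/subset_leq_card/subsetP=> A; rewrite !inE swapK.
rewrite tpermL tpermR; case: (A \in F); case: (swap i j A \in F);
  by case: (i \in A); case: (j \in A).
Qed.

Lemma card_symdiff_triangle F G H :
  (#|symdiff F H| <= #|symdiff F G| + #|symdiff G H|)%N.
Proof.
apply: leq_trans (leq_card_setU _ _); apply/subset_leq_card/subsetP=> A.
by rewrite !inE; case: (A \in F); case: (A \in G); case: (A \in H).
Qed.

Lemma not_shiftedP F : ~~ shifted F ->
  exists i j, (i < j)%N /\ (0 < #|moved i j F|)%N.
Proof.
rewrite negb_forall_in => /exists_inP[A AF] /forallPn[i] /forallPn[j].
rewrite negb_imply => /andP[/and3P[ltij jA iA]]; rewrite shift_swap // => sA.
exists i, j; split=> //; apply/card_gt0P; exists A.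
by rewrite inE AF jA iA.
Qed.

(** Induction on [Nsum], which falls at each compression since some set moves. When [m] sets move,
    the symmetric difference grows by at most [2m], while [2 * Nsum] falls by at least as much and
    [Rsum] does not drop. Doubling and moving [Rsum] to the left keep the bound in [nat]. *)
Lemma shifted_near r F : F \subset rsubsets n r ->
  exists H, [/\ H \subset rsubsets n r, shifted H, #|H| = #|F|
    & (#|symdiff F H| + 2 * Rsum F <= 2 * Nsum F)%N].
Proof.
have [N] := ubnP (Nsum F); elim: N F => // N IH F ltN sF.
have [shF|/not_shiftedP[i [j [ltij m0]]]] := boolP (shifted F).
  exists F; split=> //; rewrite /symdiff setDv setU0 cards0.
  by have := leq_Rsum_Nsum F; lia.
have leN := Nsum_compress F ltij; have leR := Rsum_compress i j F.
have [|H [sH shH cH leH]] := IH _ _ (compress_rsubsets i j sF); first by lia.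
exists H; split=> //; first by rewrite cH card_compress.
have := card_symdiff_triangle F (compress i j F) H.
by have := card_symdiff_compress i j F; lia.
Qed.

End Compression.

Theorem theorem1p1 (n r : nat) (F : {set {set 'I_n}})
    (hn : (1 <= n)%N) (hr : (2 <= r)%N) (hF : F \subset rsubsets n r) :
  (exists H : {set {set 'I_n}},
     [/\ H \subset rsubsets n r, shifted H, #|H| = #|F|
       & #|symdiff F H|%:R / 2 <= shdef F])
  /\ dist_sh r F <= shdef F.
Proof.
have [H [sH shH cH leH]] := shifted_near hF.
have bound : #|symdiff F H|%:R / 2 <= shdef F.
  rewrite shdefE ler_pdivrMr // mulrBl lerBrDr -!natrM -natrD ler_nat.
  by rewrite mulnC [(Nsum F * 2)%N]mulnC; lia.
split; first by exists H.
have [_ minH] := dist_shP hF; apply: le_trans bound; apply: minH.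
by rewrite /sh_candidate sH shH cH eqxx.
Qed.
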